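(* For the random graph process $G(t)$ on $n\ge 1$ vertices in which all edge rates equal $1$, $$\mathrm{E}(T_n(1))=\sum \binom{n}{1^{e_1},2^{e_2},\dots}\binom{e}{e_1,e_2,\dots}\frac{(-1)^e}{\frac{e}{2}\,\bigl(n^2-(1^2e_1+2^2e_2+\cdots)\bigr)},$$ $$\mathrm{E}(L_n(1))=\sum \binom{n}{1^{e_1},2^{e_2},\dots}\binom{e}{e_1,e_2,\dots}\frac{(-1)^e}{\binom{e}{2}\,\bigl(n^2-(1^2e_1+2^2e_2+\cdots)\bigr)},$$ where both sums are over all integer partitions of $n$ into two or more parts, i.e. over all sequences $(e_1,e_2,\dots)$ of nonnegative integers such that $1e_1+2e_2+\cdots=n$ and $e:=e_1+e_2+\cdots\ge 2$.
   Context: Each edge $e_{ij}$ of the complete graph $K_n$ on $\{1,\dots,n\}$ appears at a random time $t_{ij}$; the times are independent and exponentially distributed with rate $1$, i.e. $\Pr(t_{ij}>t)=e^{-t}$. $G(t)$ is the graph on $\{1,\dots,n\}$ whose edges are those with $t_{ij}\le t$. $T_n(1)$ is the first time $t\ge0$ at which $G(t)$ is connected. $L_n(1)$ is the length of the minimal spanning tree, i.e. the minimum over all spanning trees of $K_n$ of the sum of the appearance times $t_{ij}$ of the edges of the tree. Notation: $\binom{n}{1^{e_1},2^{e_2},\dots}=\dfrac{n!}{(1!)^{e_1}(2!)^{e_2}\cdots}$ and $\binom{e}{e_1,e_2,\dots}=\dfrac{e!}{e_1!\,e_2!\cdots}$. *)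

(* Defs.v *)
From HB Require Import structures.
From mathcomp Require Import all_boot all_order all_algebra.
From mathcomp Require Import all_classical all_reals all_analysis.

Set Implicit Arguments.
Unset Strict Implicit.
Unset Printing Implicit Defensive.

Import Order.TTheory GRing.Theory Num.Theory.
Local Open Scope ring_scope.

Definition edge (n : nat) := {e : {set 'I_n} | #|e| == 2%N}.

Section Graphs.
Variable n : nat.
Implicit Types F : {set edge n}.

(* A set F of edges of K_n stands for the graph on all of 'I_n with edge set F. *)
Definition adj F : rel 'I_n :=
  fun x y => [exists e in F, val e == [set x; y]%SET].

Definition graph_connected F : bool := [forall x, forall y, connect (adj F) x y].

(* The bound on the size rules out the vertex-simple closed walks x, y, x. *)
Definition acyclic F : Prop :=
  forall p : seq 'I_n, ucycle (adj F) p -> (size p < 3)%N.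

Definition spanning_tree F : Prop := graph_connected F /\ acyclic F.

End Graphs.

Section Process.
Variables (R : realType) (n : nat).
Implicit Types t : edge n -> R.

Definition graph_at t (s : R) : {set edge n} := [set e | t e <= s]%SET.

(* Both infima below are minima when 0 < n: see connection_time_first
   and mst_length_min. *)
Definition connection_time t : R :=
  inf [set s : R | 0 <= s /\ graph_connected (graph_at t s)]%classic.

Definition mst_length t : R :=
  inf [set l : R | exists2 F : {set edge n},
                     spanning_tree F & l = \sum_(e in F) t e]%classic.

End Process.

(* Product rule over every finite subfamily. *)
Definition mutually_independent d (T : measurableType d) (R : realType)
    (P : probability T R) (I : finType) (X : I -> {RV P >-> R}) : Prop :=
  forall (J : {set I}) (B : I -> set R), (forall i, measurable (B i)) ->
    P [set w | forall i, i \in J -> B i (X i w)]%classic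
    = (\prod_(i in J) P (X i @^-1` B i)%classic)%E.

Definition exponentially_distributed d (T : measurableType d) (R : realType)
    (P : probability T R) (rate : R) (X : {RV P >-> R}) : Prop :=
  forall B : set R, measurable B -> distribution P X B = exponential_prob rate B.

Section Partitions.
Variable n : nat.

(* The multiplicities (e_1, e_2, ...) of a partition of n: e i is the number of
   parts equal to i + 1.  No part and no multiplicity exceeds n. *)
Definition multiplicities := {ffun 'I_n -> 'I_n.+1}.
Implicit Type e : multiplicities.

Definition nparts e : nat := (\sum_(i < n) e i)%N.

Definition is_partition e : bool := (\sum_(i < n) i.+1 * e i == n)%N.

Definition sum_squares e : nat := (\sum_(i < n) i.+1 ^ 2 * e i)%N.

Definition multinomial_blocks (R : realType) e : R :=
  n`!%:R / \prod_(i < n) (i.+1)`!%:R ^+ e i.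

Definition multinomial_parts (R : realType) e : R :=
  (nparts e)`!%:R / \prod_(i < n) (e i)`!%:R.

End Partitions.

Section Attained.
Variables (R : realType) (n : nat).
Implicit Types t : edge n -> R.

Lemma inf_min (S : set R) (m : R) : S m -> lbound S m -> inf S = m.
Proof.
move=> Sm Sl; apply/eqP; rewrite eq_le; apply/andP; split.
  by apply: ge_inf => //; exists m.
by apply: lb_le_inf => //; exists m.
Qed.

Lemma adjS (F G : {set edge n}) : F \subset G -> subrel (adj F) (adj G).
Proof.
move=> /fintype.subsetP FG x y /existsP[e /andP[eF exy]]; apply/existsP; exists e.
by rewrite FG.
Qed.

Lemma graph_connectedS (F G : {set edge n}) :
  F \subset G -> graph_connected F -> graph_connected G.
Proof.
move=> FG /forallP cF; apply/forallP => x; apply/forallP => y.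
apply: connect_sub (forallP (cF x) y) => u v Fuv.
exact/connect1/(adjS FG).
Qed.

Lemma adj_neq (F : {set edge n}) x y : adj F x y -> x != y.
Proof.
move=> /existsP[e /andP[_ /eqP exy]]; apply/eqP => xy.
by have := valP e; rewrite exy xy finset.setUid cards1.
Qed.

Lemma adjC (F : {set edge n}) : symmetric (adj F).
Proof. by move=> x y; apply: eq_existsb => e; rewrite finset.setUC. Qed.

Lemma spanning_tree_exists : (0 < n)%N ->
  exists F : {set edge n}, spanning_tree F.
Proof.
move=> n0; pose o : 'I_n := Ordinal n0.
pose S : {set edge n} := [set e : edge n | o \in val e]%SET.
have oS x : x != o -> adj S o x.
  move=> xo; have c2 : #|[set o; x]%SET| == 2%N by rewrite cards2 (eq_sym o) xo.
  apply/existsP; exists (exist (fun A : {set 'I_n} => #|A| == 2%N) _ c2).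
  by rewrite inE /= set21 eqxx.
have Sno x y : adj S x y -> (x == o) || (y == o).
  move=> /existsP[e /andP[]]; rewrite inE => oe /eqP exy.
  by move: oe; rewrite exy !inE !(eq_sym o).
have So y x z : adj S x y -> adj S y z -> x != z -> y = o.
  move=> /Sno/orP[/eqP->|/eqP//] /Sno/orP[/eqP//|/eqP->].
  by rewrite eqxx.
exists S; split.
  have co x : connect (adj S) o x.
    by have [->|/oS/connect1//] := eqVneq x o; exact: connect0.
  apply/forallP => x; apply/forallP => y; apply: connect_trans (co y).
  by rewrite (sym_connect_sym (@adjC S)).
case=> [|x [|y [|z p]]] // /andP[/= /and3P[xy yz zp] /andP[xNyzp]].
move=> /andP[yNzp _]; exfalso.
have xz : x != z by move: xNyzp; rewrite !inE !negb_or => /and3P[].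
have yo := So _ _ _ xy yz xz.
have [u zu yu] : exists2 u, adj S z u & y != u.
  case: p zp {xNyzp} yNzp => [|u p] /= /andP[zu _].
    by exists x => //; rewrite eq_sym (adj_neq xy).
  by exists u => //; move: yNzp; rewrite !inE !negb_or => /and3P[].
by have := adj_neq yz; rewrite yo (So _ _ _ yz zu yu) eqxx.
Qed.

Lemma graph_connectedT : graph_connected [set: edge n]%SET.
Proof.
case: (posnP n) => [n0|/spanning_tree_exists[F [cF _]]].
  by apply/forallP => -[x xn]; move: (xn); rewrite n0.
exact: graph_connectedS (finset.subsetT F) cF.
Qed.

Lemma connection_time_first t : let s := connection_time t in
  [/\ 0 <= s, graph_connected (graph_at t s) &
      forall s', 0 <= s' -> graph_connected (graph_at t s') -> s <= s'].
Proof.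
pose v (F : {set edge n}) := \big[Num.max/0]_(e in F) t e.
pose F0 := [arg min_(F < [set: edge n]%SET | graph_connected F) v F]%O.
have [cF0 F0min] : graph_connected F0 /\
    (forall G, graph_connected G -> v F0 <= v G).
  by rewrite /F0; case: arg_minP => //; exact: graph_connectedT.
have v0 F : 0 <= v F by exact: bigmax_ge_id.
have cv : graph_connected (graph_at t (v F0)).
  apply: graph_connectedS cF0; apply/fintype.subsetP => e eF; rewrite inE.
  by rewrite /v (bigD1 e) //= le_max lexx.
have vle s' : 0 <= s' -> graph_connected (graph_at t s') -> v F0 <= s'.
  move=> s0 cs; apply: le_trans (F0min _ cs) _.
  apply: (big_ind (fun x => x <= s')) => // [x y xs ys|e].
    by rewrite ge_max xs ys.
  by rewrite inE.
suff -> : connection_time t = v F0 by split.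
by apply: inf_min => [//|s' /= [s0 cs]]; exact: vle.
Qed.

Lemma mst_length_min t : (0 < n)%N ->
  (exists2 F : {set edge n}, spanning_tree F & mst_length t = \sum_(e in F) t e)
  /\ (forall F : {set edge n}, spanning_tree F ->
        mst_length t <= \sum_(e in F) t e).
Proof.
move=> /spanning_tree_exists[F1 tF1].
have : `[< spanning_tree F1 >] by apply/asboolP.
case/(@arg_minP _ _ _ F1 (fun F => `[< spanning_tree F >])
       (fun F => \sum_(e in F) t e)) => F0 /asboolP tF0 F0min.
have -> : mst_length t = \sum_(e in F0) t e.
  by apply: inf_min => [|_ [F tF ->]]; [exists F0|apply/F0min/asboolP].
by split=> [|F tF]; [exists F0|apply/F0min/asboolP].
Qed.

End Attained.

(* Main.v *)
Require Import Defs.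
From HB Require Import structures.
From mathcomp Require Import all_boot all_order all_algebra.
From mathcomp Require Import all_classical all_reals all_analysis.
From mathcomp Require Import measurable_realfun.
From mathcomp Require Import ring lra.

(** View an ordered partition of the vertices into m nonempty blocks as a
    surjection f of the vertices onto m colours, and let [cross f] be the set
    of edges of K_n whose ends get different colours.  The first edge of
    [cross f] appears after an exponential time of rate [#|cross f|], so its
    mean is [1 / #|cross f|].  Both random variables of the theorem are, for
    every choice of nonnegative edge times, fixed linear combinations of these
    first crossing times ([connection_time_cuts] and [mst_length_cuts]): the
    weights are (-1)^m / m for the connection time and (-1)^m / (m (m - 1)) for
    the length of the minimal spanning tree, over all f with m >= 2.  Taking
    expectations needs nothing but linearity.

    The weights come from one polynomial identity.  Let G be a graph with k
    components and S_m the number of surjections onto m colours that are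
    monochromatic on G.  A map to j colours that is monochromatic on G is free
    on each component, so there are j^k of them; sorting them by their image
    gives j^k = sum_m S_m C(j, m).  As this holds for all j, it is an identity
    of polynomials, X^k = sum_m S_m C(X, m) ([exprX_ncomp]).  Its derivative at
    0 expresses the indicator of k = 1, and its derivative at 1 expresses k, by
    the numbers S_m ([disconnectedE] and [natr_ncomp]).

    To pass from graphs to times, list the edges in order of appearance and
    attach to a function phi of graphs the sum, over the edges e of the list,
    of the time of e multiplied by the drop of phi when e arrives
    ([drop_sum]).  This is linear in phi.  If phi is the indicator that an
    increasing property has not happened yet, the sum is the first time at
    which the property holds ([first_time_drop_sum]): this covers connectedness
    and the first crossing times.  If phi is the number of components, the sum
    is the length of the tree chosen by the greedy algorithm, which is minimal
    ([mst_length_drop_sum]).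

    What remains is to group the surjections by type.  If f has e_i fibres of
    size i, then 2 #|cross f| = n^2 - sum_i i^2 e_i.  The number of f of a given
    type is found by applying twice the same count, that of the maps with
    prescribed fibre sizes ([card_fibre]): first to the map that sends a colour
    to the size of its fibre, then to f itself. *)

Set Implicit Arguments.
Unset Strict Implicit.
Unset Printing Implicit Defensive.

Import Order.TTheory GRing.Theory Num.Theory.
Local Open Scope ring_scope.

(** * Monochromatic surjections and connected components *)

Section Colourings.
Variable n : nat.
Implicit Types F G : {set edge n}.

Definition cross (T : eqType) (f : 'I_n -> T) : {set edge n} :=
  [set e : edge n | [exists x in val e, exists y in val e, f x != f y]]%SET.

Definition ncomp G : nat := n_comp (adj G) predT.

Lemma connect_adj_sym G : connect_sym (adj G).
Proof. exact: (sym_connect_sym (@adjC n G)). Qed.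

Lemma edge_pair (e : edge n) : exists x y, x != y /\ val e = [set x; y]%SET.
Proof. exact/cards2P/(valP e). Qed.

(** A colouring avoids every edge of G exactly when it is constant along
    adjacency, hence on components. *)
Lemma monochromaticP (T : eqType) (f : 'I_n -> T) G :
  reflect (forall x y, adj G x y -> f x = f y) [disjoint cross f & G].
Proof.
apply: (iffP idP) => [dfG x y /existsP[e /andP[eG /eqP exy]]|fG].
  apply/eqP; apply: contraTT eG => fxy; rewrite (disjointFr dfG) //.
  rewrite inE; apply/exists_inP; exists x; first by rewrite exy !inE eqxx.
  by apply/exists_inP; exists y; rewrite // exy !inE eqxx orbT.
rewrite disjoint_subset; apply/fintype.subsetP => e; rewrite !inE.
case/exists_inP => x xe /exists_inP[y ye]; apply: contraNN => eG.
apply/eqP; have [xy|xy] := eqVneq x y; first by rewrite xy.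
apply: fG; apply/existsP; exists e; rewrite eG /= eq_sym eqEcard.
by rewrite (eqP (valP e)) cards2 xy andbT finset.subUset !finset.sub1set xe ye.
Qed.

Lemma connect_const (T : eqType) (f : 'I_n -> T) G :
  (forall x y, adj G x y -> f x = f y) ->
  forall x y, connect (adj G) x y -> f x = f y.
Proof.
move=> fG x _ /connectP[p xp ->].
by elim: p x xp => //= y p IH x /andP[/fG-> /IH].
Qed.

(** Such a colouring amounts to a free choice of a colour for the root of each
    component. *)
Lemma card_monochromatic (T : finType) G :
  #|[set f : {ffun 'I_n -> T} | [disjoint cross f & G]]%SET| = (#|T| ^ ncomp G)%N.
Proof.
pose C := {x | fingraph.roots (adj G) x}.
have rP x : fingraph.roots (adj G) (fingraph.root (adj G) x).
  exact: (fingraph.roots_root (connect_adj_sym G)).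
have cC : #|{: C}| = ncomp G.
  by rewrite card_sig; apply: eq_card => x; rewrite !inE andbT.
rewrite -cC -card_ffun.
pose rootC x : C := exist (fun y => is_true (fingraph.roots (adj G) y)) _ (rP x).
pose h (g : {ffun C -> T}) := [ffun x => g (rootC x)] : {ffun 'I_n -> T}.
have hI : injective h.
  move=> g1 g2 /ffunP eg; apply/ffunP => -[x rx].
  have := eg x; rewrite !ffunE.
  by congr (g1 _ = g2 _); apply/val_inj => /=; exact/eqP.
rewrite -cardsT -(card_imset _ hI); congr #|pred_of_set _|.
apply/setP => f; rewrite inE; apply/monochromaticP/imsetP => [fG|[g _ ->] x y xy].
  exists [ffun c : C => f (val c)] => //; apply/ffunP => x; rewrite !ffunE /=.
  exact: (connect_const fG) (connect_root _ _).
rewrite !ffunE; congr (g _); apply/val_inj => /=.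
by apply/eqP; rewrite (root_connect (connect_adj_sym G)) connect1.
Qed.

Definition onto (m : nat) (f : {ffun 'I_n -> 'I_m}) : bool :=
  (f @: finset.setT == finset.setT)%SET.

Definition num_mono_onto (m : nat) G : nat :=
  #|[set f : {ffun 'I_n -> 'I_m} | onto f && [disjoint cross f & G]]%SET|.

(** Numbering the elements of A turns maps with image A into surjections onto
    ['I_#|A|]. *)
Lemma card_monochromatic_image (T : finType) (A : {set T}) G :
  #|[set f : {ffun 'I_n -> T} | (f @: finset.setT == A) && [disjoint cross f & G]]%SET|
  = num_mono_onto #|A| G.
Proof.
pose h (g : {ffun 'I_n -> 'I_#|A|}) := [ffun x => enum_val (g x)] : {ffun 'I_n -> T}.
have hI : injective h.
  move=> g1 g2 /ffunP eg; apply/ffunP => x.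
  by have := eg x; rewrite !ffunE => /enum_val_inj.
rewrite /num_mono_onto -(card_imset _ hI); congr #|pred_of_set _|.
apply/setP => f; rewrite inE; apply/andP/imsetP => [[/eqP fA /monochromaticP fG]|[g]].
  have fxA x : f x \in A by rewrite -fA imset_f.
  exists [ffun x => enum_rank_in (fxA x) (f x)]; last first.
    by apply/ffunP => x; rewrite !ffunE enum_rankK_in.
  rewrite inE; apply/andP; split.
    apply/eqP/setP => i; rewrite inE; apply/imsetP.
    have /imsetP[x _ ix] : enum_val i \in (f @: finset.setT)%SET.
      by rewrite fA enum_valP.
    exists x => //; rewrite ffunE.
    by apply: enum_val_inj; rewrite enum_rankK_in.
  apply/monochromaticP => x y /fG fxy; rewrite !ffunE.
  by apply: enum_val_inj; rewrite !enum_rankK_in.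
rewrite inE => /andP[/eqP og /monochromaticP gG] ->; split; last first.
  by apply/monochromaticP => x y /gG; rewrite !ffunE => ->.
apply/eqP/setP => a; apply/imsetP/idP => [[x _ ->]|aA].
  by rewrite ffunE enum_valP.
have : enum_rank_in aA a \in (g @: finset.setT)%SET by rewrite og inE.
move=> /imsetP[x _ ax]; exists x => //.
by rewrite ffunE -ax enum_rankK_in.
Qed.

(** Both sides count the maps to j colours that are monochromatic on G, the
    right-hand side by the size m of the image.  An image has at most n
    elements. *)
Lemma expn_ncomp (j : nat) G :
  (j ^ ncomp G = \sum_(m < n.+1) 'C(j, m) * num_mono_onto m G)%N.
Proof.
have -> : (j ^ ncomp G)%N = #|[set f : {ffun 'I_n -> 'I_j} | [disjoint cross f & G]]%SET|.
  by rewrite card_monochromatic card_ord.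
have cle (T : finType) (f : {ffun 'I_n -> T}) : (#|(f @: finset.setT)%SET| < n.+1)%N.
  by rewrite ltnS (leq_trans (leq_imset_card _ _)) // cardsT card_ord.
rewrite -sum1_card (partition_big (fun f : {ffun _ -> _} => f @: finset.setT)%SET
   (fun A => #|A| < n.+1)%N) //=.
rewrite (partition_big (fun A : {set 'I_j} => inord #|A| : 'I_n.+1) predT) //=.
apply: eq_bigr => m _.
rewrite (eq_bigr (fun=> num_mono_onto m G)); last first.
  move=> A /andP[An /eqP mA].
  have <- : #|A| = m by rewrite -mA inordK.
  rewrite -card_monochromatic_image -sum1_card; apply: eq_bigl => f.
  by rewrite !inE andbC.
rewrite sum_nat_const; congr (_ * _)%N.
rewrite -[in RHS](card_ord j) -card_draws; apply: eq_card => A; rewrite !inE.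
rewrite unfold_in; apply/andP/eqP => [[An /eqP mA]|mA].
  by rewrite -mA inordK.
by rewrite mA ltn_ord; split => //; apply/eqP/val_inj; rewrite /= inordK.
Qed.

Lemma num_mono_onto1 G : (0 < n)%N -> num_mono_onto 1 G = 1%N.
Proof.
move=> n0; rewrite /num_mono_onto.
rewrite (_ : [set f | _]%SET = finset.setT) ?cardsT ?card_ffun ?card_ord ?exp1n//.
apply/setP => f; rewrite !inE; apply/andP; split.
  apply/eqP/setP => i; rewrite inE; apply/imsetP; exists (Ordinal n0) => //.
  by rewrite (ord1 i) ord1.
by apply/monochromaticP => x y _; rewrite !ord1.
Qed.

End Colourings.

Section BinomialPolynomial.
Variable R : numFieldType.

(** The binomial coefficient C(X, m) as a polynomial in X. *)
Definition bin_poly (m : nat) : {poly R} :=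
  (m`!%:R^-1) *: \prod_(i < m) ('X - i%:R%:P).

Lemma horner_bin_poly m j : (bin_poly m).[j%:R] = 'C(j, m)%:R.
Proof.
have m0 : m`!%:R != 0 :> R by rewrite pnatr_eq0 -lt0n fact_gt0.
apply: (mulfI m0); rewrite /bin_poly hornerZ mulrA mulfV // mul1r.
rewrite -natrM mulnC bin_ffact horner_prod.
under eq_bigr do rewrite hornerXsubC.
elim: m {m0} => [|m IH]; first by rewrite big_ord0.
rewrite big_ord_recr /= IH ffactnSr natrM.
have [mj|jm] := leqP m j; first by rewrite natrB.
by rewrite ffact_small // !mul0r.
Qed.

(** Reduces the derivative of a falling factorial at one of its roots to the
    value of the product of the other factors. *)
Lemma deriv_mul_XsubC (a : R) (q : {poly R}) : (('X - a%:P) * q)^`().[a] = q.[a].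
Proof. by rewrite derivM derivXsubC mul1r hornerD hornerM hornerXsubC subrr mul0r addr0. Qed.

Lemma prod_oppS m : \prod_(i < m) (- (i.+1)%:R) = (-1) ^+ m * m`!%:R :> R.
Proof.
elim: m => [|m IH]; first by rewrite big_ord0 mulr1.
by rewrite big_ord_recr /= IH factS natrM exprS; ring.
Qed.

Lemma deriv_bin_poly0 m : (bin_poly m.+1)^`().[0] = (-1) ^+ m / m.+1%:R.
Proof.
rewrite /bin_poly derivZ hornerZ big_ord_recl /= deriv_mul_XsubC horner_prod.
under eq_bigr do rewrite hornerXsubC sub0r.
rewrite prod_oppS factS natrM invfM.
have m0 : m`!%:R != 0 :> R by rewrite pnatr_eq0 -lt0n fact_gt0.
have m1 : m.+1%:R != 0 :> R by rewrite pnatr_eq0.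
by field; rewrite nat1r m0 m1.
Qed.

Lemma deriv_bin_poly1 m :
  (bin_poly m.+2)^`().[1] = (-1) ^+ m / (m.+2%:R * m.+1%:R).
Proof.
rewrite /bin_poly derivZ hornerZ big_ord_recl big_ord_recl /= mulrCA.
rewrite deriv_mul_XsubC hornerM horner_prod hornerXsubC subr0 mul1r.
rewrite (eq_bigr (fun i : 'I_m => - (i.+1)%:R)); last first.
  move=> i _; rewrite hornerXsubC /bump /= !add1n.
  by rewrite -[i.+2%:R]natr1; ring.
rewrite prod_oppS !factS !natrM !invfM.
have m0 : m`!%:R != 0 :> R by rewrite pnatr_eq0 -lt0n fact_gt0.
have m1 : m.+1%:R != 0 :> R by rewrite pnatr_eq0.
have m2 : m.+2%:R != 0 :> R by rewrite pnatr_eq0.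
by field; rewrite -natrD add2n nat1r m0 m1 m2.
Qed.

Lemma bin_poly0 : bin_poly 0 = 1.
Proof. by rewrite /bin_poly big_ord0 invr1 scale1r. Qed.

Lemma bin_poly1 : bin_poly 1 = 'X.
Proof. by rewrite /bin_poly big_ord1 invr1 scale1r subr0. Qed.

Lemma poly_eq_nat (p q : {poly R}) : (forall j : nat, p.[j%:R] = q.[j%:R]) -> p = q.
Proof.
move=> pq; apply/eqP; rewrite -subr_eq0; apply/eqP.
apply: (@roots_geq_poly_eq0 _ _ [seq j%:R | j <- iota 0 (size (p - q))]).
- by apply/allP => _ /mapP[j _ ->]; rewrite /root hornerD hornerN pq subrr.
- rewrite map_inj_uniq ?iota_uniq // => i j /eqP; rewrite eqr_nat; exact: eqP.
- by rewrite size_map size_iota.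
Qed.

End BinomialPolynomial.

Section Components.
Variables (R : numFieldType) (n : nat).
Hypothesis n_gt0 : (0 < n)%N.
Implicit Types G : {set edge n}.

(** The identity of [expn_ncomp] holds at all natural numbers, which are
    infinitely many points of a field of characteristic zero. *)
Lemma exprX_ncomp G :
  'X^(ncomp G) = \sum_(m < n.+1) (num_mono_onto m G)%:R *: bin_poly R m.
Proof.
apply: poly_eq_nat => j; rewrite hornerXn -natrX expn_ncomp natr_sum horner_sum.
by apply: eq_bigr => m _; rewrite hornerZ horner_bin_poly natrM mulrC.
Qed.

(** The term m = 0 is constant and the term m = 1 has coefficient 1
    ([num_mono_onto1]). *)
Lemma deriv_exprX_ncomp G (a : R) : (ncomp G)%:R * a ^+ (ncomp G).-1 =
  (bin_poly R 1)^`().[a] +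
  \sum_(2 <= m < n.+1) (num_mono_onto m G)%:R * (bin_poly R m)^`().[a].
Proof.
have := congr1 (fun p : {poly R} => p^`().[a]) (exprX_ncomp G).
rewrite /= derivXn hornerMn hornerXn -mulr_natl => ->.
rewrite (raddf_sum (@deriv R)) horner_sum -(big_mkord xpredT
  (fun m => ((num_mono_onto m G)%:R *: bin_poly R m)^`().[a])).
rewrite big_ltn // big_ltn // bin_poly0 num_mono_onto1 // scale1r addrA.
rewrite alg_polyC derivC horner0 add0r.
by congr (_ + _); apply: eq_bigr => m _; rewrite derivZ hornerZ.
Qed.

Lemma ncomp_gt0 G : (0 < ncomp G)%N.
Proof.
apply/card_gt0P; exists (fingraph.root (adj G) (Ordinal n_gt0)).
by rewrite inE /= andbT; apply: fingraph.roots_root; apply: connect_adj_sym.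
Qed.

(** The derivative at 0: that of X^k is 1 if k = 1 and 0 if k > 1. *)
Lemma disconnectedE G : (ncomp G != 1%N)%:R =
  \sum_(2 <= m < n.+1) (-1) ^+ m / m%:R * (num_mono_onto m G)%:R :> R.
Proof.
have := deriv_exprX_ncomp G 0.
rewrite deriv_bin_poly0 expr0 divr1.
have -> : (ncomp G)%:R * 0 ^+ (ncomp G).-1 = (ncomp G == 1%N)%:R :> R.
  case: (ncomp G) (ncomp_gt0 G) => // -[|k] _; first by rewrite expr0 mulr1.
  by rewrite expr0n mulr0.
move=> e; rewrite (_ : (_ != _)%:R = 1 - (ncomp G == 1%N)%:R); last first.
  by case: (_ == _); rewrite ?subrr ?subr0.
rewrite e opprD addNKr -sumrN big_nat_cond [RHS]big_nat_cond.
apply: eq_bigr => -[|[|m]] // _; rewrite deriv_bin_poly0.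
by rewrite [in RHS]exprS; ring.
Qed.

(** The derivative at 1: that of X^k is k. *)
Lemma natr_ncomp G : (ncomp G)%:R =
  1 + \sum_(2 <= m < n.+1) (-1) ^+ m / (m * m.-1)%:R * (num_mono_onto m G)%:R :> R.
Proof.
have := deriv_exprX_ncomp G 1; rewrite expr1n mulr1 => ->.
rewrite bin_poly1 derivX hornerC; congr (_ + _).
rewrite big_nat_cond [RHS]big_nat_cond.
apply: eq_bigr => -[|[|m]] // _; rewrite deriv_bin_poly1 /= natrM.
by rewrite [in RHS]exprS [in RHS]exprS; ring.
Qed.

End Components.

(** * Spanning subgraphs: components, cycles and edge counts *)

Section Components.
Variable n : nat.
Implicit Types A B F G : {set edge n}.

Let compset G : {set 'I_n} := [set x | fingraph.roots (adj G) x]%SET.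

Let ncompE G : ncomp G = #|compset G|.
Proof. by apply: eq_card => x; rewrite !inE andbT. Qed.

Let root_eq G x y :
  (fingraph.root (adj G) x == fingraph.root (adj G) y) = connect (adj G) x y.
Proof. exact: (root_connect (@connect_adj_sym n G)). Qed.

Let root_compset G x : fingraph.root (adj G) x \in compset G.
Proof. by rewrite inE; exact: (fingraph.roots_root (@connect_adj_sym n G)). Qed.

Let compset_root G x : x \in compset G -> fingraph.root (adj G) x = x.
Proof. by rewrite inE => /eqP. Qed.

(** When the connectivity of G' is coarser, the components of G' are the images
    of those of G. *)
Let imset_root G G' : subrel (connect (adj G)) (connect (adj G')) ->
  (fingraph.root (adj G') @: compset G)%SET = compset G'.
Proof.
move=> GG'; apply/setP => x; apply/imsetP/idP => [[y _ ->]|xG']; first exact: root_compset.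
exists (fingraph.root (adj G) x); first exact: root_compset.
rewrite -[LHS](compset_root xG'); apply/eqP; rewrite root_eq.
exact/GG'/connect_root.
Qed.

Lemma leq_ncomp G G' :
  subrel (connect (adj G)) (connect (adj G')) -> (ncomp G' <= ncomp G)%N.
Proof. by move=> /imset_root GG'; rewrite !ncompE -GG' leq_imset_card. Qed.

(** A surjection between sets of components of the same size is injective, so
    no two components have been merged. *)
Lemma eq_connect_ncomp G G' : subrel (connect (adj G)) (connect (adj G')) ->
  ncomp G' = ncomp G -> connect (adj G') =2 connect (adj G).
Proof.
move=> GG' eqk x y; apply/idP/idP => [G'xy|]; last exact: GG'.
have /imset_injP inj : #|(fingraph.root (adj G') @: compset G)%SET| == #|compset G|.
  by rewrite imset_root // -!ncompE eqk.
rewrite -root_eq; apply/eqP/inj; rewrite ?root_compset //; apply/eqP; rewrite root_eq.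
have rG z : connect (adj G') z (fingraph.root (adj G) z) by exact/GG'/connect_root.
rewrite (connect_trans _ (rG y)) // (connect_trans _ G'xy) //.
by rewrite (@connect_adj_sym n) rG.
Qed.

Lemma connectS A B : A \subset B -> subrel (connect (adj A)) (connect (adj B)).
Proof. by move=> AB; apply: connect_sub => x y /(adjS AB)/connect1. Qed.

Lemma adjU A B x y : adj (A :|: B)%SET x y = adj A x y || adj B x y.
Proof.
apply/exists_inP/orP => [[e]|[]/exists_inP[e eA exy]].
- by rewrite inE => /orP[] eA exy; [left|right]; apply/exists_inP; exists e.
- by exists e; rewrite // inE eA.
- by exists e; rewrite // inE eA orbT.
Qed.

Lemma ncomp0 : ncomp (finset.set0 : {set edge n}) = n.
Proof.
rewrite ncompE -[RHS]card_ord; apply: eq_card => x; rewrite !inE.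
have /connectP[[|y p] /= xp E] := connect_root (adj (finset.set0 : {set edge n})) x.
  by apply/eqP.
by case/andP: xp => /exists_inP[e]; rewrite inE.
Qed.

(** Only the components of the two ends of e can be merged.  The map h below
    identifies their roots, so it is constant on the components of [e |: A];
    hence the other roots stay unconnected. *)
Lemma ncomp_setU1 A (e : edge n) : (ncomp A <= (ncomp (e |: A)%SET).+1)%N.
Proof.
have [x [y [xy ve]]] := edge_pair e.
pose r := fingraph.root (adj A).
pose h a := if r a == r x then r y else r a.
have hA a b : connect (adj (e |: A)%SET) a b -> h a = h b.
  apply: connect_const => {}a {}b; rewrite adjU => /orP[/exists_inP[e']|Aab].
    rewrite inE => /eqP-> /eqP; rewrite ve => /setP eab; rewrite /h.
    have : (a \in [set x; y]%SET) && (b \in [set x; y]%SET).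
      by rewrite !eab !inE !eqxx orbT.
    have yx : (if r y == r x then r y else r y) = r y by case: ifP.
    by rewrite !inE => /andP[/orP[]/eqP-> /orP[]/eqP->]; rewrite ?eqxx ?yx.
  have rab : r a = r b by apply/eqP; rewrite root_eq connect1.
  by rewrite /h rab.
rewrite !ncompE (cardsD1 (r x)) root_compset add1n ltnS.
rewrite -(@card_in_imset _ _ (fingraph.root (adj (e |: A)%SET))) => [|a b].
  by apply/subset_leq_card/fintype.subsetP => _ /imsetP[a _ ->]; exact: root_compset.
rewrite !in_setD1 => /andP[ax aA] /andP[bx bA] /eqP; rewrite root_eq => /hA.
have [ra rb] : r a = a /\ r b = b by rewrite /r !compset_root.
by rewrite /h ra rb (negPf ax) (negPf bx).
Qed.

Lemma ncompU A B : (ncomp A <= ncomp (A :|: B)%SET + #|B|)%N.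
Proof.
rewrite cardE -[B in (A :|: B)%SET]set_enum.
elim: (enum _) A => [|e s IH] A.
  by rewrite finset.set_nil finset.setU0 addn0.
rewrite finset.set_cons finset.setUCA finset.setUA /= addnS.
by rewrite (leq_trans (ncomp_setU1 A e)) // ltnS IH.
Qed.

Lemma graph_connectedE G : (0 < n)%N -> graph_connected G = (ncomp G == 1%N).
Proof.
move=> n0; apply/idP/idP => [/forallP cG|].
  rewrite eqn_leq ncomp_gt0 // andbT ncompE; apply/card_le1_eqP => x y xG yG.
  apply/eqP; rewrite -(compset_root xG) -(compset_root yG) root_eq.
  exact: (forallP (cG y) x).
rewrite ncompE => /eqP/eq_leq/card_le1_eqP inj.
by apply/forallP => x; apply/forallP => y; rewrite -root_eq; apply/eqP/inj.
Qed.

Lemma ncompT : (0 < n)%N -> ncomp (finset.setT : {set edge n}) = 1%N.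
Proof. by move=> n0; apply/eqP; rewrite -graph_connectedE // graph_connectedT. Qed.

End Components.

Section Acyclic.
Variable n : nat.
Hypothesis n_gt0 : (0 < n)%N.
Implicit Types A B F G : {set edge n}.

(** A connected graph with fewer than n edges has no cycle: removing an edge of
    a cycle would keep it connected, but k components need at least n - k
    edges ([ncompU] with A empty). *)
Lemma connected_acyclic F : graph_connected F -> (#|F| < n)%N -> acyclic F.
Proof.
move=> cF Fn p /andP[Fp Up]; rewrite ltnNge; apply: contraL Fn => p3.
case: p Fp Up p3 => [|x [|y [|z q]]] // Fp Up _.
have /andP[/exists_inP[e eF /eqP exy] Fyz] :
  adj F x y && path (adj F) y (rcons (z :: q) x) := Fp.
have [xNyq yNzq] : x \notin [:: y, z & q] /\ y \notin z :: q.
  by move: Up => /= /and3P[].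
pose F' := (F :\ e)%SET.
(* The rest of the cycle visits x only at its end and y only at its start. *)
have F'adj u v : adj F u v -> (u != x) && (v != x) || (u != y) && (v != y) ->
    adj F' u v.
  move=> /exists_inP[e' e'F uv] xyuv; apply/exists_inP; exists e' => //.
  rewrite in_setD1 e'F andbT; apply: contraTneq xyuv => e'e.
  move: uv; rewrite e'e exy => /eqP/setP uv.
  have := uv x; have := uv y; rewrite !inE !eqxx orbT /= => /esym yuv /esym xuv.
  rewrite negb_or !negb_and !negbK !(eq_sym _ x) !(eq_sym _ y).
  by rewrite xuv yuv.
have F'yx : connect (adj F') y x.
  apply/connectP; exists (rcons (z :: q) x); last by rewrite last_rcons.
  move: Fyz; rewrite !rcons_path.
  move=> /andP[Fyq Fx]; apply/andP; split; last first.
    apply: F'adj => //; apply/orP; right.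
    have -> /= : last y (z :: q) != y.
      by apply: contraNneq yNzq => <-; rewrite /= mem_last.
    by apply: contraNneq xNyq => ->; rewrite mem_head.
  have xNy : x != y by apply: contraNneq xNyq => ->; rewrite mem_head.
  apply: (sub_in_path (P := [pred u | u != x])) Fyq => [u v ux vx Fuv|].
    by apply: F'adj => //; apply/orP; left; apply/andP.
  apply/allP => u uq; rewrite /=; apply: contraNneq xNyq => <-; exact: uq.
have eqc : subrel (connect (adj F)) (connect (adj F')).
  apply: connect_sub => u v /exists_inP[e' e'F /eqP e'uv].
  have [e'e|e'e] := eqVneq e' e; last first.
    apply/connect1/exists_inP; exists e'; rewrite ?e'uv //.
    by rewrite in_setD1 e'e.
  have F'xy : connect (adj F') x y by rewrite (@connect_adj_sym n).
  move: e'uv; rewrite e'e exy => /setP uv.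
  have := uv u; have := uv v; rewrite !inE !eqxx orbT /=.
  move=> /orP[]/eqP-> /orP[]/eqP->; rewrite ?connect0 //.
rewrite -leqNgt.
have k1 : (ncomp F' <= 1)%N.
  by rewrite (leq_trans (leq_ncomp eqc)) //; move: cF; rewrite graph_connectedE // => /eqP->.
have := ncompU (finset.set0 : {set edge n}) F'.
rewrite ncomp0 finset.set0U (cardsD1 e F) eF => /leq_trans; apply.
by rewrite leq_add2r.
Qed.

End Acyclic.

(** * Summation along the edges in order of appearance *)

Section DropSum.
Variables (R : realType) (n : nat) (t : edge n -> R).
Implicit Types (A B F G : {set edge n}) (s : seq (edge n)) (phi : {set edge n} -> R).

(** The list s is read as the edges added to A one after the other.  When s
    lists all the edges in order of appearance and A is empty, this is the
    Stieltjes integral of the time against the decrease of phi along the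
    process. *)
Fixpoint drop_sum phi A s : R :=
  if s is e :: s' then t e * (phi A - phi (e |: A)%SET) + drop_sum phi (e |: A)%SET s'
  else 0.

Lemma eq_drop_sum phi psi A s : phi =1 psi -> drop_sum phi A s = drop_sum psi A s.
Proof. by move=> pp; elim: s A => //= e s IH A; rewrite !pp IH. Qed.

Lemma drop_sum_cst phi A s : (forall G, A \subset G -> phi G = phi A) -> drop_sum phi A s = 0.
Proof.
elim: s A => //= e s IH A pA; rewrite pA ?finset.subsetUr // subrr mulr0 add0r IH // => G.
rewrite finset.subUset => /andP[_ AG].
by rewrite !pA // finset.subsetUr.
Qed.

Lemma drop_sumD phi psi A s :
  drop_sum (fun G => phi G + psi G) A s = drop_sum phi A s + drop_sum psi A s.
Proof. by elim: s A => [|e s IH] A /=; rewrite ?addr0 // IH; ring. Qed.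

Lemma drop_sumZ c phi A s : drop_sum (fun G => c * phi G) A s = c * drop_sum phi A s.
Proof. by elim: s A => [|e s IH] A /=; rewrite ?mulr0 // IH; ring. Qed.

Lemma drop_sum_big (I : Type) (r : seq I) (P : pred I) (phi : I -> {set edge n} -> R) A s :
  drop_sum (fun G => \sum_(i <- r | P i) phi i G) A s = \sum_(i <- r | P i) drop_sum (phi i) A s.
Proof.
elim: r => [|i r IH].
  by rewrite big_nil; apply: drop_sum_cst => G _; rewrite !big_nil.
rewrite big_cons -IH; case: ifP => Pi; last first.
  by apply: eq_drop_sum => G; rewrite big_cons Pi.
by rewrite -drop_sumD; apply: eq_drop_sum => G; rewrite big_cons Pi.
Qed.

Definition by_time : rel (edge n) := fun e e' => t e <= t e'.

Definition in_order : seq (edge n) := sort by_time (enum {: edge n}).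

Lemma by_time_trans : transitive by_time.
Proof. by move=> e1 e2 e3; exact: le_trans. Qed.

Lemma in_order_sorted : sorted by_time in_order.
Proof. by apply: sort_sorted => e e'; exact: le_total. Qed.

Lemma mem_in_order e : e \in in_order.
Proof. by rewrite mem_sort mem_enum. Qed.

Lemma in_order_uniq : uniq in_order.
Proof. by rewrite sort_uniq enum_uniq. Qed.

(** Summation by parts: as psi vanishes at the end, the sum is [psi A] times
    the first time, plus the values of psi at the later graphs multiplied by
    the waiting times between successive edges. *)
Lemma drop_sum_ge c psi A s : (forall G, 0 <= psi G) ->
  sorted by_time s -> (forall e, e \in s -> c <= t e) ->
  psi (A :|: [set e in s])%SET = 0 -> c * psi A <= drop_sum psi A s.
Proof.
move=> psi0; elim: s A c => [|e s IH] A c /= es sc.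
  rewrite (_ : [set e in [::]]%SET = finset.set0) ?finset.setU0; last first.
    by apply/setP => e; rewrite !inE.
  by move=> ->; rewrite mulr0.
move=> psiA; apply: (@le_trans _ _ (t e * psi A)).
  by rewrite ler_wpM2r ?sc ?mem_head.
rewrite mulrBr -[X in X <= _]addr0 -addrA lerD2l addrC subr_ge0.
apply: IH; [exact: path_sorted es| |].
  by move: es => /= /(order_path_min by_time_trans)/allP.
rewrite -psiA; congr psi; apply/setP => a; rewrite !inE.
by rewrite orbCA orbA.
Qed.

(** The indicator that Q fails drops once, from 1 to 0, at the edge e with
    which Q becomes true.  Graphs at earlier times contain neither e nor a
    later edge.  Edges may have equal times, so the graph at time [t e] may be
    larger than the one just after e is added, and monotonicity of Q bridges
    the gap. *)
Lemma drop_sum_threshold (Q : {set edge n} -> bool) A s :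
  (forall F G, F \subset G -> Q F -> Q G) -> Q finset.setT -> ~~ Q A ->
  sorted by_time s -> (forall e, (e \in A) || (e \in s)) ->
  {in A & s, forall a b, t a <= t b} ->
  exists e, [/\ drop_sum (fun G => (~~ Q G)%:R) A s = t e, Q (graph_at t (t e)) &
                forall v, Q (graph_at t v) -> t e <= v].
Proof.
move=> QS QT; elim: s A => [|e s IH] A NQA es As tAs.
  case/negP: NQA; move: QT; congr (is_true (Q _)).
  by apply/setP => e; have := As e; rewrite orbF inE => ->.
have tes : {in s, forall b, t e <= t b}.
  by move=> b; move: b; apply/allP; exact: (order_path_min by_time_trans).
have es' : sorted by_time s by exact: path_sorted es.
have [Qe|NQe] := boolP (Q (e |: A)%SET); last first.
  have [|a b|v [v1 v2 v3]] := IH _ NQe es'.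
  - by move=> a; have := As a; rewrite !inE -orbA orbCA.
  - rewrite !inE => /orP[/eqP->|aA] bs; first exact: tes.
    by apply: tAs => //; rewrite inE bs orbT.
  by exists v; split=> //=; rewrite NQA NQe subrr mulr0 add0r.
exists e; split=> /=.
- rewrite NQA Qe subr0 mulr1 drop_sum_cst ?addr0 // => G eAG.
  by rewrite Qe (QS _ _ eAG Qe).
- apply: QS Qe; apply/fintype.subsetP => a; rewrite !inE => /orP[/eqP->//|aA].
  by apply: tAs; rewrite ?mem_head.
move=> v Qv; rewrite leNgt; apply: contraNN NQA => ve; apply: QS Qv.
apply/fintype.subsetP => a; rewrite inE => av.
have := As a; rewrite inE => /or3P[//|/eqP ae|/tes].
  by move: (le_lt_trans av ve); rewrite ae ltxx.
by rewrite leNgt (le_lt_trans av ve).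
Qed.

(** [connection_time] is the case where Q is connectedness. *)
Definition first_time (Q : {set edge n} -> bool) : R :=
  inf [set s : R | 0 <= s /\ Q (graph_at t s)]%classic.

Lemma graph_atS u v : u <= v -> graph_at t u \subset graph_at t v.
Proof.
by move=> uv; apply/fintype.subsetP => e; rewrite !inE => /le_trans; apply.
Qed.

Lemma first_time_attained (Q : {set edge n} -> bool) :
  (forall F G, F \subset G -> Q F -> Q G) -> Q finset.setT ->
  [/\ 0 <= first_time Q, Q (graph_at t (first_time Q)) &
   forall v, 0 <= v -> Q (graph_at t v) -> first_time Q <= v].
Proof.
move=> QS QT.
suff [u [u0 Qu umin]] : exists u, [/\ 0 <= u, Q (graph_at t u) &
    forall v, 0 <= v -> Q (graph_at t v) -> u <= v].
  suff -> : first_time Q = u by [].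
  by apply: inf_min => // v [v0 Qv]; exact: umin.
have [Q0|NQ0] := boolP (Q (graph_at t 0)); first by exists 0; split.
(* Negative times act as 0: start from the graph at time 0. *)
pose later := [seq e <- in_order | ~~ (t e <= 0)].
have [||a b|e [_ Qe emin]] := drop_sum_threshold QS QT NQ0 (s := later).
- by apply: sorted_filter in_order_sorted; exact: by_time_trans.
- by move=> e; rewrite inE mem_filter mem_in_order andbT orbN.
- rewrite inE mem_filter -ltNge => a0 /andP[b0 _].
  exact: le_trans a0 (ltW b0).
exists (t e); split=> // [|v _]; last exact: emin.
rewrite leNgt; apply: contraNN NQ0 => /ltW/graph_atS e0.
exact: QS e0 Qe.
Qed.

Lemma first_time_le (Q : {set edge n} -> bool) v :
  (forall F G, F \subset G -> Q F -> Q G) -> Q finset.setT -> 0 <= v ->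
  (first_time Q <= v) = Q (graph_at t v).
Proof.
move=> QS QT v0; have [_ Qf fmin] := first_time_attained QS QT.
by apply/idP/idP => [/graph_atS fv|]; [exact: QS fv Qf|exact: fmin].
Qed.

Lemma first_time_drop_sum (Q : {set edge n} -> bool) : (forall e, 0 <= t e) ->
  (forall F G, F \subset G -> Q F -> Q G) -> Q finset.setT ->
  first_time Q = drop_sum (fun G => (~~ Q G)%:R) finset.set0 in_order.
Proof.
move=> t0 QS QT; have [f0 Qf fmin] := first_time_attained QS QT.
have [Q0|NQ0] := boolP (Q finset.set0).
  rewrite drop_sum_cst => [|G _]; last by rewrite Q0 (QS _ _ (finset.sub0set G) Q0).
  apply/eqP; rewrite eq_le f0 andbT fmin //.
  exact: QS (finset.sub0set _) Q0.
have [||a b|e [-> Qe emin]] := drop_sum_threshold QS QT NQ0 (s := in_order).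
- exact: in_order_sorted.
- by move=> e; rewrite mem_in_order orbT.
- by rewrite inE.
by apply/eqP; rewrite eq_le fmin // emin.
Qed.

(** The greedy algorithm: keep an edge when it merges two components of the
    graph formed by the edges before it. *)
Fixpoint kruskal A s : seq (edge n) :=
  if s is e :: s' then
    if (ncomp (e |: A)%SET < ncomp A)%N then e :: kruskal (e |: A)%SET s'
    else kruskal (e |: A)%SET s'
  else [::].

Lemma ncomp_setU1_le A e : (ncomp (e |: A)%SET <= ncomp A)%N.
Proof. exact/leq_ncomp/connectS/finset.subsetUr. Qed.

(** The number of components drops by one at the edges that are kept, and does
    not change at the others. *)
Lemma kruskal_length A s :
  \sum_(e <- kruskal A s) t e = drop_sum (fun G => (ncomp G)%:R) A s.
Proof.
elim: s A => [|e s IH] A /=; first by rewrite big_nil.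
have := ncomp_setU1_le A e; have := ncomp_setU1 A e.
case: ltnP => [lt le1 _|ge _ le]; last first.
  by rewrite (@anti_leq (ncomp A) (ncomp (e |: A)%SET)) ?ge // subrr mulr0 add0r IH.
rewrite big_cons IH; congr (_ + _).
by rewrite (@anti_leq (ncomp A) (ncomp (e |: A)%SET).+1) ?le1 // -natr1 addrAC subrr add0r mulr1.
Qed.

Lemma size_kruskal A s :
  (size (kruskal A s) + ncomp (A :|: [set e in s])%SET = ncomp A)%N.
Proof.
elim: s A => [|e s IH] A /=.
  congr (ncomp _); apply/setP => e; by rewrite !inE orbF.
have <- : (e |: A :|: [set e in s] = A :|: [set e0 in e :: s])%SET.
  by apply/setP => a; rewrite !inE orbCA orbA.
have := ncomp_setU1_le A e; have := ncomp_setU1 A e.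
case: ltnP => [lt le1 _|ge _ le]; rewrite /= ?addSn IH; apply/anti_leq.
  by rewrite lt le1.
by rewrite ge le.
Qed.

(** The edges kept so far always connect the same vertices as all the edges
    read so far; B is the set of edges kept before s. *)
Lemma connect_kruskal A B s : B \subset A -> connect (adj B) =2 connect (adj A) ->
  connect (adj (B :|: [set e in kruskal A s])%SET) =2
  connect (adj (A :|: [set e in s])%SET).
Proof.
elim: s A B => [|e s IH] A B BA cBA /=.
  have E0 C : (C :|: [set e in [::]] = C :> {set edge n})%SET.
    by apply/setP => e; rewrite !inE orbF.
  by move=> x y; rewrite !E0.
have -> : (A :|: [set e0 in e :: s] = e |: A :|: [set e in s])%SET.
  by apply/setP => a; rewrite !inE orbCA orbA.
case: ltnP => [lt|ge].
  have -> : (B :|: [set e0 in e :: kruskal (e |: A)%SET s] =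
      e |: B :|: [set e0 in kruskal (e |: A)%SET s])%SET.
    by apply/setP => a; rewrite !inE orbCA orbA.
  apply: IH => [|x y]; first exact: finset.setUS.
  apply/idP/idP; first by apply: connectS; exact: finset.setUS.
  move: x y; apply: connect_sub => x y; rewrite adjU => /orP[ex|Ax].
    by apply: connect1; rewrite adjU ex.
  have : connect (adj B) x y by rewrite cBA connect1.
  by apply: connectS; exact: finset.subsetUr.
apply: IH => [|x y]; first exact: fintype.subset_trans BA (finset.subsetUr _ _).
rewrite cBA; apply/esym/eq_connect_ncomp; first exact/connectS/finset.subsetUr.
by apply/anti_leq; rewrite ge ncomp_setU1_le.
Qed.

Lemma kruskal_subseq A s : subseq (kruskal A s) s.
Proof.
elim: s A => //= e s IH A; case: ifP => _; first by rewrite eqxx.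
exact: subseq_trans (IH _) (subseq_cons _ _).
Qed.

Lemma drop_sum_missing F A s : uniq s -> {in s, forall e, e \notin A} ->
  drop_sum (fun G => #|F :\: G|%SET%:R) A s = \sum_(e <- s | e \in F) t e.
Proof.
elim: s A => [|e s IH] A /=; first by rewrite big_nil.
move=> /andP[es us] sA; rewrite big_cons IH // => [|a aS]; last first.
  rewrite !inE negb_or sA ?inE ?aS ?orbT // andbT.
  by apply: contraNneq es => <-.
rewrite (_ : F :\: (e |: A) = (F :\: A) :\ e)%SET; last first.
  by apply/setP => a; rewrite !inE negb_or andbA.
rewrite (cardsD1 e (F :\: A)%SET) inE sA ?mem_head //=.
by case: (e \in F); [rewrite natrD addrK mulr1|rewrite subrr mulr0 add0r].
Qed.

(** The greedy edges form a spanning tree of this length.  It is minimal: for a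
    connected F0, the length of F0 is the sum attached to the number of edges
    of F0 missing from G ([drop_sum_missing]).  Since G becomes connected when
    the missing edges of F0 are added, their number is at least that of the
    components of G minus one, with equality for the complete graph; then
    [drop_sum_ge] compares the two sums. *)
Lemma mst_length_drop_sum : (0 < n)%N -> (forall e, 0 <= t e) ->
  mst_length t = drop_sum (fun G => (ncomp G)%:R) finset.set0 in_order.
Proof.
move=> n0 t0.
have [[F0 [cF0 _] mF0] mstmin] := mst_length_min t n0.
apply/eqP; rewrite eq_le; apply/andP; split.
  pose K := kruskal finset.set0 in_order.
  have UK : uniq K by exact: subseq_uniq (kruskal_subseq _ _) in_order_uniq.
  have inT : [set e in in_order]%SET = finset.setT :> {set edge n}.
    by apply/setP => e; rewrite !inE mem_in_order.
  rewrite -kruskal_length -/K.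
  rewrite (_ : \sum_(e <- K) t e = \sum_(e in [set e in K]%SET) t e); last first.
    by rewrite big_uniq //=; apply: eq_bigl => e; rewrite inE.
  apply: mstmin; have cK : graph_connected [set e in K]%SET.
    apply/forallP => x; apply/forallP => y.
    rewrite -[[set e in K]%SET]finset.set0U (connect_kruskal _ (fintype.subxx _)) //.
    by rewrite inT finset.setUT; exact: (forallP (forallP (graph_connectedT n) x)).
  split=> //; apply: connected_acyclic => //.
  rewrite (_ : #|_| = size K); last by rewrite cardsE; apply/card_uniqP.
  have := size_kruskal finset.set0 in_order.
  by rewrite -/K inT finset.setUT ncompT // ncomp0 addn1 => Kn; rewrite Kn.
pose psi G : R := #|F0 :\: G|%SET%:R + (1 - (ncomp G)%:R).
have psi0 G : 0 <= psi G.
  have := ncompU G (F0 :\: G)%SET.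
  have -> : ncomp (G :|: F0 :\: G)%SET = 1%N.
    apply/eqP; rewrite -graph_connectedE //; apply: graph_connectedS cF0.
    by apply/fintype.subsetP => e eF0; rewrite !inE eF0 andbT orbN.
  by rewrite -(ler_nat R) natrD /psi => ?; lra.
have := @drop_sum_ge 0 psi finset.set0 in_order psi0 in_order_sorted (fun e _ => t0 e).
rewrite mul0r /psi (_ : (_ :|: _)%SET = finset.setT); last first.
  by apply/setP => e; rewrite !inE mem_in_order.
rewrite finset.setDT finset.cards0 ncompT // subrr addr0 => /(_ erefl).
rewrite drop_sumD drop_sum_missing ?in_order_uniq // => [|e _]; last by rewrite inE.
have -> : \sum_(e <- in_order | e \in F0) t e = mst_length t.
  rewrite mF0 -big_filter big_uniq ?filter_uniq ?in_order_uniq //.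
  by apply: eq_bigl => e; rewrite mem_filter mem_in_order andbT.
have -> : drop_sum (fun G => 1 - (ncomp G)%:R) finset.set0 in_order =
    - drop_sum (fun G => (ncomp G)%:R) finset.set0 in_order.
  rewrite drop_sumD drop_sum_cst ?add0r // -mulN1r -drop_sumZ.
  by apply: eq_drop_sum => G; rewrite mulN1r.
by rewrite subr_ge0.
Qed.

End DropSum.

(** * The two lengths as combinations of first crossing times *)

Section Pointwise.
Variables (R : realType) (n : nat).
Hypothesis n_gt0 : (0 < n)%N.
Implicit Types (A B F G : {set edge n}) (t : edge n -> R).

Definition hits (C G : {set edge n}) : bool := ~~ [disjoint C & G].

Lemma hitsS C F G : F \subset G -> hits C F -> hits C G.
Proof. by move=> FG; apply: contraNN; exact: disjointWr. Qed.

Lemma hitsT C : C != finset.set0 -> hits C finset.setT.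
Proof. by case/set0Pn => e eC; apply/negP => /disjointFr/(_ eC); rewrite inE. Qed.

(** So the first crossing time is attained when there are two colours. *)
Lemma cross_neq0 m (f : {ffun 'I_n -> 'I_m}) : (1 < m)%N -> onto f -> cross f != finset.set0.
Proof.
move=> m1 /eqP of_; have /imsetP[x _ fx] : Ordinal (ltnW m1) \in (f @: finset.setT)%SET.
  by rewrite of_ inE.
have /imsetP[y _ fy] : Ordinal m1 \in (f @: finset.setT)%SET by rewrite of_ inE.
have fxy : f x != f y by rewrite -fx -fy.
have xy : x != y by apply: contraNneq fxy => ->.
have c2 : #|[set x; y]%SET| == 2%N by rewrite cards2 xy.
apply/set0Pn; exists (exist (fun A : {set 'I_n} => #|A| == 2%N) _ c2).
by rewrite inE; apply/exists_inP; exists x; rewrite ?set21 //;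
  apply/exists_inP; exists y; rewrite ?set22.
Qed.

Lemma natr_num_mono_onto m G :
  (num_mono_onto m G)%:R = \sum_(f : {ffun 'I_n -> 'I_m} | onto f) (~~ hits (cross f) G)%:R :> R.
Proof.
rewrite /num_mono_onto -sum1_card natr_sum big_mkcond [RHS]big_mkcond /=.
by apply: eq_bigr => f _; rewrite inE /hits negbK; case: (onto f); case: disjoint.
Qed.

Lemma drop_sum_mono_onto (c : nat -> R) t : (forall e, 0 <= t e) ->
  drop_sum t (fun G => \sum_(2 <= m < n.+1) c m * (num_mono_onto m G)%:R) finset.set0 (in_order t) =
  \sum_(2 <= m < n.+1) \sum_(f : {ffun 'I_n -> 'I_m} | onto f)
     c m * first_time t (hits (cross f)).
Proof.
move=> t0; rewrite drop_sum_big big_nat_cond [RHS]big_nat_cond.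
apply: eq_bigr => m /andP[/andP[m1 _] _]; rewrite drop_sumZ -mulr_sumr; congr (_ * _).
under eq_drop_sum do rewrite natr_num_mono_onto.
rewrite drop_sum_big; apply: eq_bigr => f of_; rewrite -first_time_drop_sum //.
  by move=> F G; exact: hitsS.
exact/hitsT/cross_neq0.
Qed.

(** The sum attached to both sides of [disconnectedE]. *)
Lemma connection_time_cuts t : (forall e, 0 <= t e) -> connection_time t =
  \sum_(2 <= m < n.+1) \sum_(f : {ffun 'I_n -> 'I_m} | onto f)
     (-1) ^+ m / m%:R * first_time t (hits (cross f)).
Proof.
move=> t0; rewrite -[LHS]/(first_time t (@graph_connected n)).
rewrite first_time_drop_sum //; last 2 first.
- exact: graph_connectedS.
- exact: graph_connectedT.
rewrite -(drop_sum_mono_onto (fun m => (-1) ^+ m / m%:R)) //.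
by apply: eq_drop_sum => G; rewrite graph_connectedE // disconnectedE.
Qed.

(** The sum attached to both sides of [natr_ncomp]; the constant 1 never
    drops. *)
Lemma mst_length_cuts t : (forall e, 0 <= t e) -> mst_length t =
  \sum_(2 <= m < n.+1) \sum_(f : {ffun 'I_n -> 'I_m} | onto f)
     (-1) ^+ m / (m * m.-1)%:R * first_time t (hits (cross f)).
Proof.
move=> t0; rewrite mst_length_drop_sum //.
rewrite -(drop_sum_mono_onto (fun m => (-1) ^+ m / (m * m.-1)%:R)) //.
rewrite (eq_drop_sum _ (psi := fun G => 1 +
  \sum_(2 <= m < n.+1) (-1) ^+ m / (m * m.-1)%:R * (num_mono_onto m G)%:R)) => [|G].
  by rewrite drop_sumD drop_sum_cst ?add0r.
by rewrite natr_ncomp.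
Qed.

End Pointwise.

(** * Exponential first crossing times *)

Section Measurability.
Context d (T : measurableType d) (R : realType).

Lemma measurable_fun_le_sets (X : T -> R) :
  (forall r, measurable [set w | X w <= r]%classic) -> measurable_fun setT X.
Proof.
move=> mX _; apply: (measurability _ (RGenOInfty.measurableE R)) => //.
move=> _ [_ [r ->] <-]; rewrite setTI.
rewrite (_ : _ @^-1` _ = ~` [set w | X w <= r])%classic; first exact: measurableC.
by apply/seteqP; split => w /=; rewrite in_itv /= andbT ltNge => /negP.
Qed.

Lemma measurable_le (X : T -> R) (r : R) :
  measurable_fun setT X -> measurable [set w | X w <= r]%classic.
Proof.
move=> mX; rewrite -[X in measurable X]setTI.
rewrite (_ : [set w | _]%classic = X @^-1` `]-oo, r]%classic)%classic; first exact: mX.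
by apply/seteqP; split => w /=; rewrite in_itv.
Qed.

Lemma measurable_exists (I : finType) (A : I -> set T) (D : pred I) :
  (forall i, D i -> measurable (A i)) ->
  measurable [set w | exists2 i, D i & A i w]%classic.
Proof.
move=> mA; rewrite (_ : [set w | _]%classic = \bigcup_(i in [set i | D i]) A i)%classic.
  exact: fin_bigcup_measurable.
by apply/seteqP; split => w /= [i Di Aw]; exists i.
Qed.

Lemma measurable_forall (I : finType) (A : I -> set T) (D : pred I) :
  (forall i, D i -> measurable (A i)) ->
  measurable [set w | forall i, D i -> A i w]%classic.
Proof.
move=> mA; rewrite (_ : [set w | _]%classic = \bigcap_(i in [set i | D i]) A i)%classic.
  exact: fin_bigcap_measurable.
by apply/seteqP; split => w /= Aw i Di; apply: Aw.
Qed.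

Variables (n : nat) (t : edge n -> T -> R).
Hypothesis mt : forall e, measurable_fun setT (t e).

(** The property holds at time r if and only if one of the finitely many graphs
    F with the property has all its edges by time r. *)
Lemma measurable_first_time (Q : {set edge n} -> bool) :
  (forall F G : {set edge n}, F \subset G -> Q F -> Q G) -> Q finset.setT ->
  measurable_fun setT (fun w => first_time (fun e => t e w) Q).
Proof.
move=> QS QT; apply: measurable_fun_le_sets => r.
have [r0|r0] := leP 0 r; last first.
  rewrite (_ : [set w | _]%classic = set0) //.
  apply/seteqP; split => w //=; apply/negP; rewrite -ltNge.
  by have [f0 _ _] := first_time_attained (fun e => t e w) QS QT; exact: lt_le_trans f0.
rewrite (_ : [set w | _]%classic =
    [set w | exists2 F : {set edge n}, Q F & forall e, e \in F -> t e w <= r]%classic).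
  by apply: measurable_exists => F _; apply: measurable_forall => e _; exact: measurable_le.
apply/seteqP; split => w /=; rewrite first_time_le //.
  by move=> Qr; exists (graph_at (fun e => t e w) r) => // e; rewrite inE.
move=> [F QF Fr]; apply: QS QF; apply/fintype.subsetP => e eF; rewrite inE; exact: Fr.
Qed.

Lemma measurable_mst_length : (0 < n)%N ->
  measurable_fun setT (fun w => mst_length (fun e => t e w)).
Proof.
move=> n0; apply: measurable_fun_le_sets => r.
rewrite (_ : [set w | _]%classic = [set w | exists2 F : {set edge n},
    `[< spanning_tree F >] & \sum_(e in F) t e w <= r]%classic).
  apply: measurable_exists => F _; apply: measurable_le.
  by under eq_fun do rewrite -big_enum; exact: measurable_sum.
apply/seteqP; split => w /=; have [[F0 tF0 mF0] mle] := mst_length_min (fun e => t e w) n0.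
  by move=> mr; exists F0; [exact/asboolP|rewrite -mF0].
by move=> [F /asboolP/mle mF]; exact: le_trans.
Qed.

End Measurability.

Section Exponential.
Context d (T : measurableType d) (R : realType) (P : probability T R).

Lemma exponential_lt0 (rate : R) (X : {RV P >-> R}) :
  exponentially_distributed rate X -> P [set w | X w < 0]%classic = 0%E.
Proof.
move=> eX; rewrite (_ : [set w | _]%classic = X @^-1` `]-oo, 0[)%classic; last first.
  by apply/seteqP; split => w /=; rewrite in_itv.
rewrite -[LHS]/(distribution P X _) eX // /exponential_prob integral0_eq // => x /=.
by rewrite in_itv /= => x0; rewrite lt0_exponential_pdf.
Qed.

(** For s = 0 the interval from 0 to s is a point, of measure zero. *)
Lemma exponential_gt (X : {RV P >-> R}) (rate s : R) :
  exponentially_distributed rate X -> 0 <= s ->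
  P (X @^-1` `]s, +oo[)%classic = (expR (- rate * s))%:E.
Proof.
move=> eX s0.
have e0s : exponential_prob rate `[0, s]%classic = (1 - (expR (- rate * s))%:E)%E.
  move: s0; rewrite le_eqVlt => /predU1P[<-|]; last exact: exponential_prob_itv0c.
  rewrite set_itv1 /exponential_prob integral_set1 mulr0 expR0 subee //.
rewrite (_ : X @^-1` _ = ~` ([set w | X w < 0] `|` X @^-1` `[0%R, s]))%classic; last first.
  apply/seteqP; split => w /=; rewrite !in_itv /= andbT.
    by move=> sw; case; [rewrite ltNge (le_trans s0 (ltW sw))|rewrite [X w <= s]leNgt sw andbF].
  move=> /not_orP[/negP]; rewrite -leNgt => -> /negP /=; by rewrite -ltNge.
have mlt0 : measurable [set w | X w < 0]%classic.
  rewrite (_ : [set w | _]%classic = X @^-1` `]-oo, 0[)%classic.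
    exact: measurable_funPTI.
  by apply/seteqP; split => w /=; rewrite in_itv.
have m0s : measurable (X @^-1` `[0%R, s])%classic by exact: measurable_funPTI.
rewrite probability_setC; last exact: measurableU.
rewrite measureU //; last first.
  apply/seteqP; split => w //= [w0]; rewrite in_itv /= leNgt w0 //.
have := exponential_lt0 eX; rewrite /= => ->.
rewrite add0e -[X in (_ - X)%E]/(distribution P X _) eX // e0s.
by rewrite -EFinD opprB addrC subrK.
Qed.

End Exponential.

Section ExpectedCutTime.
Context d (T : measurableType d) (R : realType) (P : probability T R) (n : nat).
Variable t : edge n -> {RV P >-> R}.
Hypothesis indep : mutually_independent t.
Hypothesis expo : forall e, exponentially_distributed 1 (t e).

(** No edge of C has appeared at time s; by independence the tails multiply. *)
Lemma first_cut_gt (C : {set edge n}) (s : R) : C != finset.set0 -> 0 <= s ->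
  P [set w | s < first_time (fun e => t e w) (hits C)]%classic
  = (expR (- #|C|%:R * s))%:E.
Proof.
move=> C0 s0; rewrite (_ : [set w | _]%classic =
    [set w | forall e, e \in C -> `]s, +oo[%classic (t e w)]%classic); last first.
  apply/seteqP; split => w /=; rewrite ltNge first_time_le ?hitsT //;
    try exact: hitsS.
    rewrite negbK => dC e eC; rewrite in_itv /= andbT.
    by have := disjointFr dC eC; rewrite inE ltNge => ->.
  move=> Ct; rewrite negbK; apply/pred0P => e /=; rewrite inE.
  by apply: contraTF isT => /andP[/Ct]; rewrite in_itv /= andbT ltNge => /negPf->.
rewrite (indep C (B := fun=> `]s, +oo[%classic)) //.
rewrite (eq_bigr (fun=> (expR (- s))%:E)) => [|e _]; last first.
  by rewrite (exponential_gt (expo e)) // mulN1r.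
rewrite prodEFin prodr_const -expRM_natl.
by rewrite mulrN mulNr.
Qed.

(** The density of rate c is c times the integrand and has integral 1. *)
Lemma integral_expR_tail (c : R) : 0 < c ->
  (\int[lebesgue_measure]_(s in `[0%R, +oo[) (expR (- c * s))%:E = c^-1%:E)%E.
Proof.
move=> c0.
rewrite -[RHS]mule1 -(integral_exponential_pdf c0) -ge0_integralZl_EFin //; last first.
- by rewrite invr_ge0 ltW.
- by apply/measurable_EFinP; exact: measurable_exponential_pdf.
- by move=> x _; rewrite lee_fin exponential_pdf_ge0 // ltW.
rewrite [LHS]integral_mkcond; apply: eq_integral => x _.
rewrite /exponential_pdf !patchE; case: ifP => _; last by rewrite mule0.
by rewrite -EFinM mulKf // gt_eqF.
Qed.

(** The mean of a nonnegative variable is the integral of its tail. *)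
Lemma expectation_first_cut_neq0 (C : {set edge n}) : C != finset.set0 ->
  (\int[P]_w (first_time (fun e => t e w) (hits C))%:E = (#|C|%:R^-1)%:E)%E.
Proof.
move=> C0; pose X w := first_time (fun e => t e w) (hits C).
have mX : measurable_fun setT X.
  by apply: measurable_first_time => [e|F G|]; [|exact: hitsS|exact: hitsT].
pose Y : {RV P >-> R} := HB.pack X (isMeasurableFun.Build _ _ _ _ X mX).
have Y0 w : 0 <= Y w.
  by have [] := first_time_attained (fun e => t e w) (@hitsS n C) (hitsT C0).
rewrite -[LHS](expectation_def Y) ge0_expectation_ccdf //.
rewrite -integral_expR_tail ?ltr0n ?card_gt0 //.
apply: eq_integral => s; rewrite inE /= in_itv /= andbT => s0.
rewrite -first_cut_gt // /ccdf /distribution /pushforward /=.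
by congr (P _); apply/seteqP; split => w /=; rewrite in_itv /= andbT.
Qed.

(** By convention the infimum of the empty set is 0, as is the inverse of 0.
    Hence the mean below is right for every C, and the sums over all maps need
    no side condition. *)
Lemma first_cut0 (u : edge n -> R) : first_time u (hits finset.set0) = 0.
Proof.
rewrite /first_time (_ : [set s | _]%classic = set0) ?inf0 //.
by apply/seteqP; split => s //= [_]; rewrite /hits finset.disjoints_subset finset.sub0set.
Qed.

Lemma expectation_first_cut (C : {set edge n}) :
  (\int[P]_w (first_time (fun e => t e w) (hits C))%:E = (#|C|%:R^-1)%:E)%E.
Proof.
have [->|C0] := eqVneq C finset.set0; last exact: expectation_first_cut_neq0.
by rewrite finset.cards0 invr0 integral0_eq // => w _; rewrite first_cut0.
Qed.

Lemma integrable_first_cut (C : {set edge n}) :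
  P.-integrable setT (fun w => (first_time (fun e => t e w) (hits C))%:E).
Proof.
have [->|C0] := eqVneq C finset.set0.
  by under eq_fun do rewrite first_cut0; exact: integrable0.
apply/integrableP; split.
  apply/measurable_EFinP.
  by apply: measurable_first_time => [e|F G|]; [|exact: hitsS|exact: hitsT].
under eq_integral => w _.
  have [f0 _ _] := first_time_attained (fun e => t e w) (@hitsS n C) (hitsT C0).
  rewrite gee0_abs ?lee_fin //; over.
by rewrite expectation_first_cut // ltry.
Qed.

Lemma ae_times_ge0 : {ae P, forall w, forall e, 0 <= t e w}.
Proof.
apply: filter_forall => e.
exists [set w | t e w < 0]%classic; split.
- rewrite (_ : [set w | _]%classic = t e @^-1` `]-oo, 0[)%classic.
    exact: measurable_funPTI.
  by apply/seteqP; split => w /=; rewrite in_itv.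
- exact: exponential_lt0 (expo e).
- by move=> w /= /negP; rewrite -ltNge.
Qed.

(** The identity for h holds for nonnegative times, that is almost surely. *)
Lemma expectation_cut_sum (h : (edge n -> R) -> R) (c : nat -> R) :
  measurable_fun setT (fun w => h (fun e => t e w)) ->
  (forall u : edge n -> R, (forall e, 0 <= u e) -> h u =
    \sum_(2 <= m < n.+1) \sum_(f : {ffun 'I_n -> 'I_m} | onto f)
      c m * first_time u (hits (cross f))) ->
  ('E_P[fun w => h (fun e => t e w)] =
   (\sum_(2 <= m < n.+1) \sum_(f : {ffun 'I_n -> 'I_m} | onto f)
      c m / #|cross f|%:R)%:E)%E.
Proof.
move=> mh hE; rewrite unlock.
have icut m (f : {ffun 'I_n -> 'I_m}) : P.-integrable setT
    (fun w => (c m)%:E * (first_time (fun e => t e w) (hits (cross f)))%:E)%E.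
  by apply: integrableZl => //; exact: integrable_first_cut.
have icuts m : P.-integrable setT
    (fun w => \sum_(f : {ffun 'I_n -> 'I_m} | onto f)
      (c m)%:E * (first_time (fun e => t e w) (hits (cross f)))%:E)%E.
  by apply: integrable_sum.
pose g w : \bar R := (\sum_(2 <= m < n.+1) \sum_(f : {ffun 'I_n -> 'I_m} | onto f)
  (c m)%:E * (first_time (fun e => t e w) (hits (cross f)))%:E)%E.
have ig : P.-integrable setT g by apply: integrable_sum.
transitivity (\int[P]_w g w)%E.
  apply: ae_eq_integral => //.
  - exact/measurable_EFinP.
  - by case/integrableP: ig.
  apply: filterS ae_times_ge0 => w tw _.
  rewrite hE // /g -sumEFin; apply: eq_bigr => m _.
  by rewrite -sumEFin.
rewrite /g integral_sum // -sumEFin; apply: eq_bigr => m _.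
rewrite integral_sum // -sumEFin; apply: eq_bigr => f _.
by rewrite integralZl // ?expectation_first_cut //; exact: integrable_first_cut.
Qed.
End ExpectedCutTime.

(** * Counting surjections by the sizes of their fibres *)

Section Fibres.
Local Open Scope nat_scope.

Definition fibre (N : nat) (J : eqType) (f : 'I_N -> J) (j : J) : nat :=
  \sum_(i < N) (f i == j).

Lemma sum_fibre (N : nat) (J : finType) (f : 'I_N -> J) (phi : J -> nat) :
  \sum_j phi j * fibre f j = \sum_(i < N) phi (f i).
Proof.
rewrite (eq_bigr (fun j => \sum_(i < N) phi j * (f i == j))) => [|j _]; last first.
  by rewrite big_distrr.
rewrite exchange_big /=; apply: eq_bigr => i _.
rewrite (bigD1 (f i)) //= eqxx muln1 big1 ?addn0 // => j /negPf fij.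
by rewrite eq_sym fij muln0.
Qed.

Lemma fibre_gt0 (N : nat) (J : eqType) (f : 'I_N -> J) (i : 'I_N) : 0 < fibre f (f i).
Proof. by rewrite /fibre (bigD1 i) //= eqxx. Qed.

Lemma onto_fibreE N m (f : {ffun 'I_N -> 'I_m}) :
  onto f = [forall j, 0 < fibre f j].
Proof.
apply/eqP/forallP => [fT j|f0].
  have /imsetP[i _ ->] : j \in (f @: finset.setT)%SET by rewrite fT inE.
  exact: fibre_gt0.
apply/setP => j; rewrite [RHS]inE; apply/imsetP; apply: contrapT => nf.
have := f0 j; rewrite /fibre big1 // => i _; apply/eqP; rewrite eqb0.
by apply/eqP => fij; apply: nf; exists i.
Qed.

(** The multinomial count.  Induction on N: removing the first point, of colour
    j0, lowers the fibre size at j0 by one, and multiplying by the factorials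
    of the sizes turns the recurrence into (N + 1)! = sum_j b_j N!. *)
Lemma card_fibre (N : nat) (J : finType) (b : J -> nat) : \sum_j b j = N ->
  #|[set f : {ffun 'I_N -> J} | [forall j, fibre f j == b j]]%SET| * \prod_j (b j)`!
  = N`!.
Proof.
elim: N b => [|N IH] b sb.
  have b0 j : b j = 0.
    by apply/eqP; move/eqP: sb; rewrite sum_nat_eq0 => /forallP/(_ j).
  rewrite [X in _ * X]big1 => [|j _]; last by rewrite b0.
  rewrite muln1 (_ : finset _ = finset.setT) ?cardsT ?card_ffun ?card_ord ?expn0 //.
  by apply/setP => f; rewrite !inE; apply/forallP => j; rewrite b0 /fibre big_ord0.
pose ext (p : J * {ffun 'I_N -> J}) : {ffun 'I_N.+1 -> J} :=
  [ffun i => if unlift ord0 i is Some k then p.2 k else p.1].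
pose res (f : {ffun 'I_N.+1 -> J}) := (f ord0, [ffun k => f (lift ord0 k)]).
have extK : cancel ext res.
  move=> [j g]; rewrite /res /ext ffunE unlift_none /=; congr (_, _).
  by apply/ffunP => k; rewrite !ffunE liftK.
have resK : cancel res ext.
  move=> f; apply/ffunP => i; rewrite ffunE.
  by case: unliftP => [k|] -> /=; rewrite ?ffunE.
have fibext j0 g j : fibre (ext (j0, g)) j = (j0 == j) + fibre g j.
  rewrite /fibre big_ord_recl ffunE unlift_none; congr (_ + _).
  by apply: eq_bigr => k _; rewrite ffunE liftK.
rewrite -sum1_card (reindex ext); last by exists res => x _; [exact: extK|exact: resK].
rewrite (eq_bigl (fun p : J * {ffun _ -> J} =>
  [forall j, (p.1 == j) + fibre p.2 j == b j])); last first.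
  by move=> [j0 g]; rewrite inE; apply: eq_forallb => j; rewrite fibext.
rewrite -(pair_big_dep predT (fun j0 (g : {ffun 'I_N -> J}) =>
   [forall j, (j0 == j) + fibre g j == b j]) (fun _ _ => 1)) /=.
rewrite big_distrl factS -sb big_distrl /=; apply: eq_bigr => j0 _.
have [b0|b0] := posnP (b j0).
  rewrite b0 mul0n big_pred0 // => g; apply/negP => /forallP/(_ j0).
  by rewrite eqxx b0.
pose b' j := b j - (j0 == j).
have bb' j : b j = (j0 == j) + b' j.
  by rewrite /b' subnKC //; case: eqVneq => // <-.
have sb' : \sum_j b' j = N.
  have : \sum_j b j = 1 + \sum_j b' j.
    rewrite (eq_bigr _ (fun j _ => bb' j)) big_split /=; congr (_ + _).
    by rewrite (bigD1 j0) //= eqxx big1 // => j /negPf; rewrite eq_sym => ->.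
  by rewrite sb add1n => -[].
rewrite -(IH _ sb') mulnCA; congr (_ * _).
  rewrite -sum1_card; apply: eq_bigl => g; rewrite inE.
  by apply: eq_forallb => j; rewrite bb' eqn_add2l.
rewrite (bigD1 j0) //= [in RHS](bigD1 j0) //= mulnA; congr (_ * _).
  by rewrite bb' eqxx add1n factS.
by apply: eq_bigr => j /negPf; rewrite bb' eq_sym => ->.
Qed.

(** An ordered pair of vertices is either monochromatic, which happens for
    sum_j (size of fibre j)^2 pairs, or is one of the two orders of a crossing
    edge. *)
Lemma card_cross n m (f : {ffun 'I_n -> 'I_m}) :
  2 * #|cross f| + \sum_j fibre f j ^ 2 = n ^ 2.
Proof.
have -> : 2 * #|cross f| = \sum_(p : 'I_n * 'I_n) (f p.1 != f p.2).
  rewrite mulnC -sum_nat_const.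
  transitivity (\sum_(e in cross f) \sum_(p : 'I_n * 'I_n) (val e == [set p.1; p.2]%SET)).
    apply: eq_bigr => e _; have [x [y [xy ve]]] := edge_pair e.
    transitivity #|[set (x, y); (y, x)]%SET|.
      by rewrite cards2 xpair_eqE (negPf xy).
    rewrite -sum1_card big_mkcond /=; apply: eq_bigr => -[u v] _; rewrite ve !inE !xpair_eqE /=.
    have -> : ([set x; y] == [set u; v])%SET = (u == x) && (v == y) || (u == y) && (v == x).
      apply/eqP/orP => [/setP uv|[]/andP[/eqP-> /eqP->] //]; last exact: finset.setUC.
      have := uv u; have := uv v; have := uv x; have := uv y.
      rewrite !inE !eqxx !orbT /=.
      move=> /esym yuv /esym xuv vxy uxy.
      move: uxy vxy xuv yuv; case/orP => /eqP->; case/orP => /eqP->;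
        rewrite !eqxx ?orbT; auto.
        by rewrite eq_sym orbb => _ /eqP xy'; move: xy; rewrite xy' eqxx.
      by rewrite orbb => /eqP xy'; move: xy; rewrite xy' eqxx.
    by case: orP.
  rewrite exchange_big /=; apply: eq_bigr => -[x y] _ /=.
  have [fxy|fxy] /= := eqVneq (f x) (f y).
    apply: big1 => e; rewrite inE => /exists_inP[u ue /exists_inP[v ve]].
    apply: contraTeq; rewrite eqb0 negbK => /eqP exy.
    by move: ue ve; rewrite /= exy !inE => /orP[]/eqP-> /orP[]/eqP->; rewrite ?fxy ?eqxx.
  have xy : x != y by apply: contraNneq fxy => ->.
  have c2 : #|[set x; y]%SET| == 2 by rewrite cards2 xy.
  pose e0 : edge n := exist (fun A : {set 'I_n} => #|A| == 2) _ c2.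
  have e0c : e0 \in cross f.
    rewrite inE; apply/exists_inP; exists x; rewrite ?set21 //.
    by apply/exists_inP; exists y; rewrite ?set22.
  rewrite (bigD1 e0) //= eqxx big1 // => e /andP[_ ee0].
  by apply/eqP; rewrite eqb0; apply: contraNN ee0 => /eqP ev; apply/eqP/val_inj.
have -> : \sum_j fibre f j ^ 2 = \sum_(p : 'I_n * 'I_n) (f p.1 == f p.2).
  rewrite -(pair_big predT predT (fun x y => nat_of_bool (f x == f y))) /=.
  under eq_bigr do rewrite expnS expn1.
  rewrite sum_fibre; apply: eq_bigr => x _.
  by apply: eq_bigr => y _; rewrite eq_sym.
rewrite -big_split /= (eq_bigr (fun=> 1)) => [|p _]; last by case: eqP.
by rewrite sum1_card card_prod card_ord.
Qed.

End Fibres.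

Lemma prod_fibre (N : nat) (J : finType) (f : 'I_N -> J) (phi : J -> nat) :
  (\prod_j phi j ^ fibre f j = \prod_(i < N) phi (f i))%N.
Proof.
rewrite (eq_bigr (fun j => \prod_(i < N) phi j ^ (f i == j))%N) => [|j _]; last first.
  by rewrite expn_sum.
rewrite exchange_big /=; apply: eq_bigr => i _.
rewrite (bigD1 (f i)) //= eqxx expn1 big1 ?muln1 // => j /negPf fij.
by rewrite eq_sym fij expn0.
Qed.

Lemma fibre_le (N : nat) (J : eqType) (f : 'I_N -> J) j : (fibre f j <= N)%N.
Proof.
rewrite -[leqRHS]card_ord -sum1_card; apply: leq_sum => i _; exact: leq_b1.
Qed.

Section GroupByType.
Variables (R : numFieldType) (n m : nat).
Hypotheses (n_gt0 : (0 < n)%N) (mn : (m <= n)%N).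

(** A size s between 1 and n is encoded as s - 1, an element of ['I_n]; this
    agrees with the indexing of [multiplicities], where the index i stands for
    parts of size i + 1. *)
Definition block_sizes (f : {ffun 'I_n -> 'I_m}) : {ffun 'I_m -> 'I_n} :=
  [ffun j => insubd (Ordinal n_gt0) (fibre f j).-1].

Lemma block_sizesE (f : {ffun 'I_n -> 'I_m}) (a : {ffun 'I_m -> 'I_n}) :
  onto f && (block_sizes f == a) = [forall j, fibre f j == (a j).+1].
Proof.
rewrite onto_fibreE; apply/andP/forallP => [[/forallP f0 /eqP<- j]|fa].
  rewrite ffunE val_insubd prednK // ?fibre_le ?prednK //.
split; first by apply/forallP => j; rewrite (eqP (fa j)).
apply/eqP/ffunP => j; apply: val_inj; rewrite ffunE val_insubd (eqP (fa j)) /=.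
by rewrite ltn_ord.
Qed.

Definition size_counts (a : {ffun 'I_m -> 'I_n}) : multiplicities n :=
  [ffun i => inord (fibre a i)].

Lemma size_countsE (a : {ffun 'I_m -> 'I_n}) (e : multiplicities n) :
  (size_counts a == e) = [forall i, fibre a i == e i].
Proof.
apply/eqP/forallP => [<- i|ae].
  by rewrite ffunE inordK // ltnS (leq_trans (fibre_le _ _)).
by apply/ffunP => i; apply: val_inj; rewrite ffunE (eqP (ae i)) inord_val.
Qed.

Lemma natrX_sub_cross (f : {ffun 'I_n -> 'I_m}) :
  n%:R ^+ 2 - (\sum_j fibre f j ^ 2)%N%:R = 2 * #|cross f|%:R :> R.
Proof. by rewrite -natrX -(card_cross f) natrD natrM addrK. Qed.

(** The summand depends only on the fibre sizes, so [card_fibre] applies. *)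
Lemma sum_onto_sizes (c : R) :
  \sum_(f : {ffun 'I_n -> 'I_m} | onto f) c / #|cross f|%:R =
  \sum_(a : {ffun 'I_m -> 'I_n} | (\sum_j (a j).+1 == n)%N)
    n`!%:R / (\prod_j ((a j).+1)`!)%N%:R *
    (c * 2 / (n%:R ^+ 2 - (\sum_j (a j).+1 ^ 2)%N%:R)).
Proof.
rewrite (partition_big block_sizes (fun a => \sum_j (a j).+1 == n)%N) /=; last first.
  move=> f of_; have := block_sizesE f (block_sizes f).
  rewrite of_ eqxx => /esym/forallP fa.
  rewrite -(eq_bigr _ (fun j _ => eqP (fa j))).
  rewrite -[X in _ == X]card_ord -sum1_card -(sum_fibre f (fun=> 1%N)).
  by apply/eqP/eq_bigr => j _; rewrite mul1n.
apply: eq_bigr => a /eqP an.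
rewrite (eq_bigl _ _ (fun f => block_sizesE f a)).
rewrite (eq_bigr (fun=> c * 2 / (n%:R ^+ 2 - (\sum_j (a j).+1 ^ 2)%N%:R))); last first.
  move=> f /forallP fa.
  rewrite -(eq_bigr _ (fun j _ => congr1 (fun k => k ^ 2)%N (eqP (fa j)))).
  by rewrite natrX_sub_cross invfM mulrA mulfK // pnatr_eq0.
rewrite sumr_const -[LHS]mulr_natl; congr (_ * _).
rewrite -(card_fibre an) natrM mulfK.
  by congr (_%:R); apply: eq_card => f; rewrite !inE.
by rewrite pnatr_eq0 -lt0n prodn_gt0 // => j; exact: fact_gt0.
Qed.

(** The summand of [sum_onto_sizes] depends only on how often each size occurs,
    and these numbers are the fibre sizes of the map a; so [card_fibre] applies
    once more. *)
Lemma sum_onto (c : R) :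
  \sum_(f : {ffun 'I_n -> 'I_m} | onto f) c / #|cross f|%:R =
  \sum_(e : multiplicities n | is_partition e && (nparts e == m))
    n`!%:R / \prod_(i < n) (i.+1)`!%:R ^+ e i *
    ((nparts e)`!%:R / \prod_(i < n) (e i)`!%:R) *
    (c * 2 / (n%:R ^+ 2 - (sum_squares e)%:R)).
Proof.
have fromcounts (phi : nat -> nat) (a : {ffun 'I_m -> 'I_n}) (e : multiplicities n) :
    [forall i, fibre a i == e i] -> (\sum_(i < n) phi i * e i = \sum_j phi (a j))%N.
  move=> /forallP ae; rewrite -(sum_fibre a phi).
  by apply: eq_bigr => i _; rewrite (eqP (ae i)).
rewrite sum_onto_sizes (partition_big size_counts
  (fun e => is_partition e && (nparts e == m))) /=; last first.
  move=> a an; have ae : [forall i, fibre a i == size_counts a i].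
    by rewrite -size_countsE.
  rewrite /is_partition (fromcounts succn _ _ ae) an /nparts.
  have := fromcounts (fun=> 1%N) _ _ ae; rewrite sum1_card card_ord => cm.
  by apply/eqP; apply: etrans cm; apply: eq_bigr => i _; rewrite mul1n.
apply: eq_bigr => e /andP[pe /eqP em].
rewrite (eq_bigl (fun a : {ffun 'I_m -> 'I_n} => [forall i, fibre a i == e i])) => [|a]; last first.
  rewrite size_countsE andb_idl // => ae; rewrite -(fromcounts succn _ _ ae).
  exact: pe.
rewrite (eq_bigr (fun=> n`!%:R / \prod_(i < n) (i.+1)`!%:R ^+ e i *
    (c * 2 / (n%:R ^+ 2 - (sum_squares e)%:R)))); last first.
  move=> a ae; rewrite /sum_squares (fromcounts (fun k => k.+1 ^ 2)%N _ _ ae).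
  rewrite -(prod_fibre a (fun i => (i.+1)`!)) natr_prod.
  congr (_ / _ * _); apply: eq_bigr => i _.
  by rewrite natrX (eqP (forallP ae i)).
rewrite sumr_const -[LHS]mulr_natr em -(card_fibre (b := fun i => e i) em) natrM natr_prod.
rewrite mulfK; last by apply/prodf_neq0 => i _; rewrite pnatr_eq0 -lt0n fact_gt0.
rewrite [RHS]mulrAC; congr (_ * _%:R); apply: eq_card => a; by rewrite !inE.
Qed.
End GroupByType.

Section Weights.
Variables (R : realType) (n : nat).
Hypothesis n_gt0 : (0 < n)%N.

Lemma nparts_le (e : multiplicities n) : is_partition e -> (nparts e <= n)%N.
Proof.
move=> /eqP {2}<-; apply: leq_sum => i _; exact: leq_pmull.
Qed.

Lemma sum_cuts_partitions (c w : nat -> R) :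
  (forall k, (1 < k)%N -> c k * 2 = w k) ->
  \sum_(2 <= m < n.+1) \sum_(f : {ffun 'I_n -> 'I_m} | onto f) c m / #|cross f|%:R =
  \sum_(e : multiplicities n | is_partition e && (2 <= nparts e)%N)
       multinomial_blocks R e * multinomial_parts R e *
       (w (nparts e) / (n%:R ^+ 2 - (sum_squares e)%:R)).
Proof.
move=> cw.
rewrite [RHS](partition_big (fun e => inord (nparts e) : 'I_n.+1)
  (fun m => 2 <= m)%N) /=; last first.
  by move=> e /andP[pe e2]; rewrite inordK // ltnS nparts_le.
rewrite big_geq_mkord; apply: eq_bigr => m /= m2; rewrite sum_onto // -1?ltnS //.
apply: eq_big => [e|e /andP[_ /eqP em]]; last first.
  by rewrite /multinomial_blocks /multinomial_parts em cw.
have [pe /=|//] := boolP (is_partition e).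
have pn := nparts_le pe.
apply/eqP/andP => [->|[_ /eqP <-]]; last by rewrite inordK // ltnS.
by rewrite m2; split=> //; apply/eqP/val_inj; rewrite /= inordK.
Qed.
End Weights.


Theorem corollary1p2 (d : measure_display) (Omega : measurableType d)
    (R : realType) (P : probability Omega R) (n : nat)
    (t : edge n -> {RV P >-> R}) :
  (1 <= n)%N ->
  mutually_independent t ->
  (forall e : edge n, exponentially_distributed 1 (t e)) ->
  ('E_P[fun w => connection_time (fun e => t e w)])%E =
    (\sum_(e : multiplicities n | is_partition e && (2 <= nparts e)%N)
       multinomial_blocks R e * multinomial_parts R e *
       ((-1) ^+ nparts e /
        ((nparts e)%:R / 2 * (n%:R ^+ 2 - (sum_squares e)%:R))))%:E
  /\
  ('E_P[fun w => mst_length (fun e => t e w)])%E =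
    (\sum_(e : multiplicities n | is_partition e && (2 <= nparts e)%N)
       multinomial_blocks R e * multinomial_parts R e *
       ((-1) ^+ nparts e /
        ('C(nparts e, 2)%:R * (n%:R ^+ 2 - (sum_squares e)%:R))))%:E.
Proof.
move=> n_gt0 indep expo; split.
  rewrite (expectation_cut_sum indep expo (c := fun m => (-1) ^+ m / m%:R)); last 2 first.
  - apply: (@measurable_first_time _ _ _ _ (fun e => t e)) => //.
      exact: graph_connectedS.
    exact: graph_connectedT.
  - by move=> u; exact: connection_time_cuts.
  rewrite (sum_cuts_partitions n_gt0 (w := fun m => (-1) ^+ m / (m%:R / 2))) => [|m _].
    by congr (_%:E); apply: eq_bigr => e _; rewrite [in RHS]invfM !mulrA.
  by rewrite invfM invrK mulrA.
rewrite (expectation_cut_sum indep expo (c := fun m => (-1) ^+ m / (m * m.-1)%:R)); last 2 first.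
- exact: (@measurable_mst_length _ _ _ _ (fun e => t e)).
- by move=> u; exact: mst_length_cuts.
rewrite (sum_cuts_partitions n_gt0 (w := fun m => (-1) ^+ m / 'C(m, 2)%:R)) => [|m m2].
  by congr (_%:E); apply: eq_bigr => e _; rewrite [in RHS]invfM !mulrA.
have -> : (m * m.-1 = 'C(m, 2) * 2)%N by rewrite (bin_ffact m 2) ffactnS ffactn1.
by rewrite natrM invfM -!mulrA mulVf ?mulr1 // pnatr_eq0.
Qed.
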